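(* Let $d\ge 3$ be an odd integer. The Hausdorff dimension of the closure $\overline{G_d}$ of $G_d$ in $\mathrm{Aut}(T)$ is $$\dim_H(\overline{G_d})=1-\frac{\log 2}{d\,\log (d!)}.$$
   Context: Let $d\ge 3$ be odd and $X=\{1,\dots,d\}$. Let $T$ be the $d$-regular rooted tree whose vertex set is the set $X^*$ of finite words over $X$, with root the empty word, the children of $u$ being $ux$, $x\in X$; $X^k$ is the $k$-th level. $\mathrm{Aut}(T)$ is the (profinite) group of root-preserving graph automorphisms of $T$, with product $gh(u)=h(g(u))$ and identity $e$. For $g\in\mathrm{Aut}(T)$ and $u\in X^*$, the section $g|_u\in\mathrm{Aut}(T)$ is determined by $g(uv)=g(u)\,g|_u(v)$ for all $v\in X^*$. The wreath recursion of $g$ is $g=(g|_1,\dots,g|_d)\lambda_g$, where $\lambda_g\in S_d$ is the permutation induced by $g$ on $X$; it determines $g$. The group $G_d\le \mathrm{Aut}(T)$ is generated by $A=\{a_1,\dots,a_d\}$, defined recursively by: for $1\le i\le d-1$, $\lambda_{a_i}=(i\ \,i+1)$, $a_i|_i=a_i$, $a_i|_{i+1}=a_{i+1}$, and $a_i|_x=e$ for all other $x\in X$; and $\lambda_{a_d}=(d\ 1)$, $a_d|_1=a_1$, $a_d|_d=a_d$, and $a_d|_x=e$ for all other $x\in X$. For $G\le\mathrm{Aut}(T)$, $\mathrm{St}_{G}(\widehat{k})$ is the subgroup of elements of $G$ fixing every vertex of $X^k$, and the Hausdorff dimension of the closure of $G$ in $\mathrm{Aut}(T)$ is given by $$\dim_H(\overline{G})=\liminf_{k\to\infty}\frac{\log\,[G:\mathrm{St}_G(\widehat{k})]}{\log\,[\mathrm{Aut}(T):\mathrm{St}_{\mathrm{Aut}(T)}(\widehat{k})]}.$$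 *)

(* Defs.v *)
From HB Require Import structures.
From mathcomp Require Import all_boot all_order all_algebra perm.
From mathcomp Require Import finmap all_classical all_reals all_analysis.

Set Implicit Arguments.
Unset Strict Implicit.
Unset Printing Implicit Defensive.

Local Open Scope classical_set_scope.

(* The letters 1, ..., d of the alphabet X are represented by the elements
   0, ..., d-1 of 'I_d; vertices of the d-regular rooted tree T are words. *)
Definition word (d : nat) := seq 'I_d.

Definition adjacent (d : nat) (u v : word d) : Prop :=
  exists x, v = rcons u x \/ u = rcons v x.

Definition is_tree_aut (d : nat) (f : word d -> word d) : Prop :=
  [/\ bijective f, f [::] = [::]
    & forall u v, adjacent (f u) (f v) <-> adjacent u v].

(* Aut(T). *)
Record tree_aut (d : nat) := TreeAut {
  tree_aut_fun :> word d -> word d;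
  tree_autP : is_tree_aut tree_aut_fun }.

HB.instance Definition _ (d : nat) := gen_eqMixin (tree_aut d).
HB.instance Definition _ (d : nat) := gen_choiceMixin (tree_aut d).

Section TreeAutGroup.
Variable d : nat.
Implicit Types g h : tree_aut d.

Lemma tree_aut_ext g h : g =1 h -> g = h.
Proof.
case: g h => [f fP] [f' f'P] /= /funext eq_ff'; subst f'.
by rewrite (Prop_irrelevance fP f'P).
Qed.

Lemma is_tree_aut_id : is_tree_aut (@id (word d)).
Proof. by split=> //; exists id. Qed.

Lemma is_tree_aut_comp (f f' : word d -> word d) :
  is_tree_aut f -> is_tree_aut f' -> is_tree_aut (f' \o f).
Proof.
move=> [bf f0 fA] [bf' f'0 f'A]; split; first exact: bij_comp.
  by rewrite /= f0.
by move=> u v /=; rewrite f'A.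
Qed.

Lemma is_tree_aut_inv (f f' : word d -> word d) :
  is_tree_aut f -> cancel f f' -> cancel f' f -> is_tree_aut f'.
Proof.
move=> [bf f0 fA] fK f'K; split; first by exists f.
  by rewrite -{1}f0 fK.
by move=> u v; rewrite -fA !f'K.
Qed.

Lemma tree_aut_inverse g : {f | cancel g f /\ cancel f g}.
Proof. by apply: cid; case: (tree_autP g) => -[f gK fK] _ _; exists f. Qed.

Definition tree_aut_one : tree_aut d := TreeAut is_tree_aut_id.

(* The product convention is (g h)(u) = h (g u). *)
Definition tree_aut_mul g h : tree_aut d :=
  TreeAut (is_tree_aut_comp (tree_autP g) (tree_autP h)).

Definition tree_aut_inv g : tree_aut d :=
  TreeAut (is_tree_aut_inv (tree_autP g)
    (svalP (tree_aut_inverse g)).1 (svalP (tree_aut_inverse g)).2).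

Lemma tree_aut_mulA : associative tree_aut_mul.
Proof. by move=> f g h; apply: tree_aut_ext. Qed.

Lemma tree_aut_mul1 : left_id tree_aut_one tree_aut_mul.
Proof. by move=> g; apply: tree_aut_ext. Qed.

Lemma tree_aut_mulr1 : right_id tree_aut_one tree_aut_mul.
Proof. by move=> g; apply: tree_aut_ext. Qed.

Lemma tree_aut_mulV : left_inverse tree_aut_one tree_aut_inv tree_aut_mul.
Proof.
move=> g; apply: tree_aut_ext => u /=.
exact: (svalP (tree_aut_inverse g)).2.
Qed.

Lemma tree_aut_mulrV : right_inverse tree_aut_one tree_aut_inv tree_aut_mul.
Proof.
move=> g; apply: tree_aut_ext => u /=.
exact: (svalP (tree_aut_inverse g)).1.
Qed.

End TreeAutGroup.

HB.instance Definition _ (d : nat) := isGroup.Build (tree_aut d)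
  (@tree_aut_mulA d) (@tree_aut_mul1 d) (@tree_aut_mulr1 d)
  (@tree_aut_mulV d) (@tree_aut_mulrV d).

(* The indices of the generators are cyclic: ordS i is i+1 modulo d, so the
   rule for a_d, with d and 1 in place of i and i+1, is the case of the last
   index. Each clause reads a_i (x v) = lambda_{a_i}(x) a_i|_x (v). *)
Fixpoint gen_fun (d : nat) (i : 'I_d) (w : word d) : word d :=
  match w with
  | [::] => [::]
  | x :: v =>
      tperm i (ordS i) x ::
        (if x == i then gen_fun i v
         else if x == ordS i then gen_fun (ordS i) v
         else v)
  end.

Section Generators.
Variable d : nat.
Implicit Types (i x : 'I_d) (u v w : word d).

Fixpoint gen_inv_fun i w : word d :=
  match w with
  | [::] => [::]
  | x :: v =>
      let y := tperm i (ordS i) x in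
      y :: (if y == i then gen_inv_fun i v
            else if y == ordS i then gen_inv_fun (ordS i) v
            else v)
  end.

Lemma gen_funK i : cancel (gen_fun i) (gen_inv_fun i).
Proof.
move=> w; elim: w i => //= x v IH i; rewrite tpermK; congr (_ :: _).
by case: eqP => // _; case: eqP.
Qed.

Lemma gen_inv_funK i : cancel (gen_inv_fun i) (gen_fun i).
Proof.
move=> w; elim: w i => //= x v IH i; rewrite tpermK; congr (_ :: _).
by case: eqP => // _; case: eqP.
Qed.

Lemma gen_fun_rcons i u x : exists y, gen_fun i (rcons u x) = rcons (gen_fun i u) y.
Proof.
elim: u i => [|z u IH] i /=; first by eexists; case: ifP => _ //; case: ifP.
case: ifP => _; first by have [y ->] := IH i; exists y.
case: ifP => _; first by have [y ->] := IH (ordS i); exists y.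
by exists x.
Qed.

Lemma gen_inv_fun_rcons i u x :
  exists y, gen_inv_fun i (rcons u x) = rcons (gen_inv_fun i u) y.
Proof.
elim: u i => [|z u IH] i /=; first by eexists; case: ifP => _ //; case: ifP.
case: ifP => _; first by have [y ->] := IH i; exists y.
case: ifP => _; first by have [y ->] := IH (ordS i); exists y.
by exists x.
Qed.

Lemma is_tree_aut_gen i : is_tree_aut (gen_fun i).
Proof.
split=> //; first by exists (gen_inv_fun i); [exact: gen_funK|exact: gen_inv_funK].
move=> u v; split=> -[x [] E].
- have [y Ey] := gen_inv_fun_rcons i (gen_fun i u) x.
  by exists y; left; rewrite -(gen_funK i v) E Ey gen_funK.
- have [y Ey] := gen_inv_fun_rcons i (gen_fun i v) x.
  by exists y; right; rewrite -(gen_funK i u) E Ey gen_funK.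
- by rewrite E; have [y ->] := gen_fun_rcons i u x; exists y; left.
- by rewrite E; have [y ->] := gen_fun_rcons i v x; exists y; right.
Qed.

Definition gen i : tree_aut d := TreeAut (is_tree_aut_gen i).

End Generators.

Definition is_subgroup (gT : groupType) (H : set gT) : Prop :=
  [/\ H 1%g, forall x y, H x -> H y -> H (x * y)%g
    & forall x, H x -> H (x^-1)%g].

Definition generated (gT : groupType) (A : set gT) : set gT :=
  smallest (@is_subgroup gT) A.

(* The number of cosets g H with g in G (0 if there are infinitely many). *)
Definition group_index (gT : groupType) (G H : set gT) : nat :=
  #|` fset_set [set [set (g * h)%g | h in H] | g in G] |%fset.

(* The stabilizer in G of all the vertices of level k. *)
Definition level_stab (d : nat) (G : set (tree_aut d)) (k : nat)
    : set (tree_aut d) :=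
  [set g | G g /\ forall u : word d, size u = k -> g u = u].

(* The Hausdorff dimension of the closure of the subgroup G in Aut(T). At
   k = 0 the quotient is 0 / 0 = 0, which does not affect the limit. *)
Definition dimH_closure (R : realType) (d : nat) (G : set (tree_aut d))
    : \bar R :=
  limn_einf (fun k : nat =>
    (ln (group_index G (level_stab G k))%:R
       / ln (group_index setT (level_stab (@setT (tree_aut d)) k))%:R)%R%:E).

Definition Gd (d : nat) : set (tree_aut d) := generated (range (@gen d)).

(* Main.v *)
Require Import Defs.
From HB Require Import structures.
From mathcomp Require Import all_boot all_order all_algebra all_fingroup all_solvable.
From mathcomp Require Import finmap all_classical all_reals all_analysis.
From mathcomp Require Import fintype finset ring.

Set Implicit Arguments.
Unset Strict Implicit.
Unset Printing Implicit Defensive.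

Local Open Scope group_scope.

(** The sections of a generator a_i are a_i, a_(i+1) and the identity, so their
    total parity, counted by the signs of the permutations induced on the first
    level, is even. This parity is additive along products; hence for every g in
    the group and every vertex u, the signs of the permutations that g induces
    below the children of u multiply to 1. That is one binary constraint for
    each vertex, and the claim is that there are no others: the action on the
    words of length k + 1 consists of all automorphisms meeting the constraints
    at the vertices of length less than k. If v_k is the number of those
    vertices, the order of this finite quotient is d! ^ v_(k+1) / 2 ^ v_k,
    against d! ^ v_(k+1) for the full automorphism group; since v_k / v_(k+1)
    tends to 1 / d, the quotient of the logarithms tends to
    1 - ln 2 / (d ln d!).

    That the constraints suffice is proved by induction on the level. Let H be
    the group generated by the a_i on one level and K the group generated by
    their lifts b_i one level further down. The induction carries along the fact
    that the even elements of H lie in its commutator subgroup.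
    - The rigid stabilizers of all first-level vertices in K are equal as
      subgroups of H, and normal in H (rist_const, rist_norm). The braid relation
      between b_i and b_(i+1) fails in a single section (braid), which makes
      all a_i equal modulo the rigid stabilizer; therefore the latter contains
      the commutator subgroup of H (rist_der), and by induction all even
      elements of H.
    - It remains to realize permutations and parities. Walking around the cycle
      of letters in the two directions gives two lifts of each transposition,
      and because d is odd they differ by a pair of odd sections (odd_pair).
      Together this shows that K is given by the parity constraint
      (gen_even_sections), which yields its order (card_gen).
    - In the abelianization of K all b_i are equal and have trivial square, so
      the even elements of K are in its commutator subgroup (even_der).

    The wreath products used for the induction are tied to the tree by their
    action on words (lact): each automorphism agrees on the words of length k
    with exactly one element of the k-fold wreath product (lact_exists,
    lact_inj), so that indices of level stabilizers are orders of finite groups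
    (group_index_level). *)

(** * The cyclic order on the alphabet *)

Section Cyc.
Variable d : nat.
Implicit Types i j : 'I_d.

Lemma val_iter_ordS k i : iter k (@ordS d) i = (i + k) %% d :> nat.
Proof.
elim: k => [|k IH] /=; first by rewrite addn0 modn_small.
by rewrite IH -[in LHS]addn1 modnDml addn1 addnS.
Qed.

Lemma iter_ordS_period i : iter d (@ordS d) i = i.
Proof. by apply: val_inj; rewrite /= val_iter_ordS modnDr modn_small. Qed.

Lemma iter_ordS_neq k i : 0 < k < d -> iter k (@ordS d) i != i.
Proof.
case/andP=> k0 kd; apply/eqP => /(congr1 val) /=; rewrite val_iter_ordS => E.
have lid := ltn_ord i.
have: k == 0 %[mod d] by rewrite -(eqn_modDl i) addn0 E modn_small.
by rewrite mod0n modn_small // eqn0Ngt k0.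
Qed.

Lemma iter_ordS_onto i j : i != j -> exists2 k, 0 < k < d & j = iter k (@ordS d) i.
Proof.
move=> nij; have lid := ltn_ord i; have ljd := ltn_ord j.
(* The cyclic distance from i to j. *)
pose k := (j + (d - i)) %% d.
have E : j = iter k (@ordS d) i.
  apply: val_inj; rewrite /= val_iter_ordS modnDmr addnCA subnKC ?(ltnW lid) //.
  by rewrite modnDr modn_small.
exists k => //; rewrite ltn_mod (leq_ltn_trans _ lid) // andbT lt0n.
by apply: contra nij => /eqP k0; rewrite E k0.
Qed.

(** For odd d, adding 2 generates the integers modulo d: stepping by 2
    (d + 1) / 2 times amounts to stepping by 1. *)
Lemma cyc_const (T : Type) (P : 'I_d -> T) i j :
  odd d -> (forall x, P x = P (ordS (ordS x))) -> P i = P j.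
Proof.
move=> oddd P2.
have Pe k x : P x = P (iter k.*2 (@ordS d) x).
  by elim: k => [//|k IH]; rewrite doubleS /= -P2.
have P1 x : P x = P (ordS x).
  rewrite (Pe (d.+1)./2 x) even_halfK /= ?oddd //.
  by rewrite -[in RHS](iter_ordS_period x).
case: (eqVneq i j) => [->//|/iter_ordS_onto [k _ ->]].
by elim: k => [//|k IH]; rewrite IH P1.
Qed.
End Cyc.

(** * Permutational wreath products *)

Definition wreath (d : nat) (gT : finGroupType) :=
  ({ffun 'I_d -> gT} * 'S_d)%type.

Section WreathGroup.
Variables (d : nat) (gT : finGroupType).
Implicit Types u v w : wreath d gT.

HB.instance Definition _ := Finite.on (wreath d gT).

Definition wr (f : 'I_d -> gT) (s : 'S_d) : wreath d gT := (finfun f, s).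
(** The wreath recursion of a product g h, with g acting first: the section of
    g h at x is g|_x h|_(g x). *)
Definition wr_mul u v := wr (fun x => u.1 x * v.1 (u.2 x)) (u.2 * v.2).
Definition wr_one := wr (fun=> 1) 1.
Definition wr_inv u := wr (fun x => (u.1 (u.2^-1 x))^-1) u.2^-1.

Lemma wr_ext u v : u.1 =1 v.1 -> u.2 = v.2 -> u = v.
Proof. by case: u v => [f s] [f' s'] /= /ffunP -> ->. Qed.

Lemma wr_mulA : associative wr_mul.
Proof.
move=> u v w; apply: wr_ext => [x|] /=; last exact: mulgA.
by rewrite !ffunE permM mulgA.
Qed.

Lemma wr_mul1 : left_id wr_one wr_mul.
Proof.
by move=> u; apply: wr_ext => [x|] /=; rewrite ?mul1g // !ffunE perm1 mul1g.
Qed.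

Lemma wr_mulV : left_inverse wr_one wr_inv wr_mul.
Proof.
by move=> u; apply: wr_ext => [x|] /=; rewrite ?mulVg // !ffunE mulVg.
Qed.

HB.instance Definition _ := Finite_isGroup.Build (wreath d gT)
  wr_mulA wr_mul1 wr_mulV.

Lemma wrM1 u v x : (u * v).1 x = u.1 x * v.1 (u.2 x).
Proof. by rewrite ffunE. Qed.
Lemma wrM2 u v : (u * v).2 = u.2 * v.2. Proof. by []. Qed.
Lemma wr11 x : (1 : wreath d gT).1 x = 1. Proof. by rewrite ffunE. Qed.
Lemma wrV1 u x : (u^-1).1 x = (u.1 (u.2^-1 x))^-1. Proof. by rewrite ffunE. Qed.
Lemma wrV2 u : (u^-1).2 = u.2^-1. Proof. by []. Qed.

Definition single (x : 'I_d) (h : gT) := wr (fun y => if y == x then h else 1) 1.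

(** Conjugation moves an element supported below the letter x to the letter
    u.2 x and conjugates it by the section of u at x; every transport of
    elements between subtrees below rests on this. *)
Lemma singleJ x h u : single x h ^ u = single (u.2 x) (h ^ u.1 x).
Proof.
apply: (@mulgI _ u); rewrite -conjgC.
apply: wr_ext => [y|]; last by rewrite !wrM2 mulg1 mul1g.
rewrite !wrM1 !ffunE perm1 (inj_eq perm_inj).
by case: eqP => [->|_]; rewrite ?mulg1 ?mul1g // -conjgC.
Qed.

Lemma singleM x h k : single x (h * k) = single x h * single x k.
Proof.
apply: wr_ext => [y|]; last by rewrite wrM2 mulg1.
by rewrite !wrM1 !ffunE perm1; case: ifP; rewrite ?mulg1.
Qed.

Lemma single1 x : single x 1 = 1.
Proof. by apply: wr_ext => [y|] //; rewrite !ffunE if_same. Qed.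

End WreathGroup.

(** * From one level to the next *)

(** One level is added here to the finite quotients of the group. Given a_i in
    a finite group, the elements b_i satisfy the wreath recursion of the
    generators over the a_i; H and K are the groups generated by the a_i and
    by the b_i. In the tower, sgn is the parity of the permutation induced on
    the first level, so that c is true except over the trivial group, where
    sgn is constantly false. *)
Section LevelStep.
Variables (d : nat) (gT : finGroupType) (a : 'I_d -> gT) (sgn : gT -> bool) (c : bool).
Hypotheses (d3 : 3 <= d) (oddd : odd d).
Hypothesis sgnM : forall x y, sgn (x * y) = sgn x (+) sgn y.
Hypothesis sgna : forall i, sgn (a i) = c.
Let H := <<[set a i | i : 'I_d]>>.
Hypothesis derH : forall h, h \in H -> ~~ sgn h -> h \in H^`(1).

Implicit Types (i j x y : 'I_d) (u v : wreath d gT).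

Definition wr_gen i : wreath d gT :=
  wr (fun x => if x == i then a i else if x == ordS i then a (ordS i) else 1)
     (tperm i (ordS i)).
Local Notation b := wr_gen.
Let K := <<[set b i | i : 'I_d]>>.

Definition sect_parity (u : wreath d gT) : bool := \big[addb/false]_x sgn (u.1 x).

Lemma mem_lower i : a i \in H. Proof. by apply: mem_gen; apply: imset_f. Qed.
Lemma mem_upper i : b i \in K. Proof. by apply: mem_gen; apply: imset_f. Qed.

Lemma sgn1 : sgn 1 = false.
Proof. by have := sgnM 1 1; rewrite mulg1 addbb. Qed.

Lemma sgnV (x : gT) : sgn x^-1 = sgn x.
Proof. by have := sgnM x^-1 x; rewrite mulVg sgn1; do 2!case: sgn. Qed.

Lemma ordS_neq (i : 'I_d) : ordS i != i.
Proof. by apply: (@iter_ordS_neq d 1); rewrite (ltn_trans _ d3). Qed.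

Lemma ordSS_neq (i : 'I_d) : ordS (ordS i) != i.
Proof. exact: (@iter_ordS_neq d 2). Qed.

Lemma sgn_gen i x : sgn ((b i).1 x) = c && (x \in [:: i; ordS i]).
Proof.
rewrite ffunE !inE; case: eqP => _ /=; first by rewrite sgna andbT.
by case: eqP => _; rewrite ?sgna ?sgn1 ?andbT ?andbF.
Qed.

Lemma sect_parityM u v : sect_parity (u * v) = sect_parity u (+) sect_parity v.
Proof.
rewrite /sect_parity [X in _ (+) X](reindex_inj (@perm_inj _ u.2)) /= -big_split /=.
by apply: eq_bigr => x _; rewrite wrM1 sgnM.
Qed.

Lemma sect_parity_gen i : sect_parity (b i) = false.
Proof.
rewrite /sect_parity (bigD1 i) //= (bigD1 (ordS i)) ?ordS_neq //= big1.
  by rewrite !sgn_gen !inE !eqxx orbT addbA addbb.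
by move=> x /andP[xi xj]; rewrite sgn_gen !inE (negPf xi) (negPf xj) andbF.
Qed.

(** The constraint that cuts one bit per vertex: each b_i has exactly two
    nontrivial sections, both of parity c, so the parities of the sections of
    any product of the b_i add up to zero. *)
Definition even_sections : {set wreath d gT} :=
  [set u : wreath d gT | [forall x, u.1 x \in H] && ~~ sect_parity u].

Lemma even_sectionsP u :
  reflect ((forall x, u.1 x \in H) /\ ~~ sect_parity u) (u \in even_sections).
Proof. by rewrite inE; apply: (iffP andP) => -[/forallP]. Qed.

Lemma even_sections_group_set : group_set even_sections.
Proof.
apply/group_setP; split=> [|u v /even_sectionsP[uH u0] /even_sectionsP[vH v0]].
  apply/even_sectionsP; split=> [x|]; first by rewrite wr11 group1.
  by have := sect_parityM 1 1; rewrite mulg1 addbb => ->.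
apply/even_sectionsP; split=> [x|]; first by rewrite wrM1 groupM.
by rewrite sect_parityM (negPf u0) (negPf v0).
Qed.

Lemma gen_sub_even_sections : K \subset even_sections.
Proof.
pose E := Group even_sections_group_set.
rewrite -[even_sections]/(gval E) gen_subG; apply/subsetP => _ /imsetP[i _ ->].
apply/even_sectionsP; rewrite sect_parity_gen; split=> // x; rewrite ffunE.
by case: ifP => _; [|case: ifP => _]; rewrite ?mem_lower ?group1.
Qed.

(** The rigid stabilizer of the letter x, seen inside gT. *)
Definition rist x : {set gT} := [set h | single x h \in K].

Lemma rist_forward j h : (h \in rist j) = (h ^ a j \in rist (ordS j)).
Proof.
rewrite !inE -(memJ_norm (single j h) (subsetP (normG _) _ (mem_upper j))) singleJ.
by rewrite tpermL ffunE eqxx.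
Qed.

Lemma rist_backward j h : (h \in rist (ordS j)) = (h ^ a (ordS j) \in rist j).
Proof.
rewrite !inE -(memJ_norm (single _ h) (subsetP (normG _) _ (mem_upper j))) singleJ.
by rewrite tpermR ffunE (negPf (ordS_neq j)) eqxx.
Qed.

(** Conjugating by b_j from j + 1 back to j, or by b_(j+1) from j + 1 on to
    j + 2, involves the same section a_(j+1); so the rigid stabilizers at j
    and j + 2 coincide, and oddness of d joins all letters. *)
Lemma rist_const x y : rist x = rist y.
Proof.
apply: (@cyc_const _ _ rist) => // j; apply/setP => h.
have e : h = (h ^ (a (ordS j))^-1) ^ a (ordS j) by rewrite conjgKV.
by rewrite e -rist_backward rist_forward.
Qed.

(** As the rigid stabilizers at j and j + 1 are equal, conjugation by a_j,
    which carries the first to the second, preserves them. *)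
Lemma ristJ x h j : (h \in rist x) = (h ^ a j \in rist x).
Proof. by rewrite (rist_const x j) rist_forward (rist_const (ordS j) j). Qed.

Lemma rist_group_set x : group_set (rist x).
Proof.
apply/group_setP; split=> [|h k]; rewrite !inE; first by rewrite single1 group1.
by rewrite singleM; apply: groupM.
Qed.

Lemma rist_norm x : H \subset 'N(rist x).
Proof.
rewrite gen_subG; apply/subsetP => _ /imsetP[j _ ->]; rewrite inE.
apply/subsetP => _ /imsetP[h hx ->]; by rewrite -ristJ.
Qed.

Definition braid_elt i :=
  a (ordS i) * a i * (a (ordS (ordS i)))^-1 * (a (ordS i))^-1.

(** The transpositions underlying b_i and b_(i+1) satisfy the braid relation.
    For b_i and b_(i+1) themselves it holds in all sections except the one at
    i + 1, which produces an element of the rigid stabilizer. *)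
Lemma braid i : b i * b (ordS i) * b i
  = single (ordS i) (braid_elt i) * (b (ordS i) * b i * b (ordS i)).
Proof.
rewrite /b /braid_elt.
have n1 := ordS_neq i; have n2 := ordS_neq (ordS i); have n3 := ordSS_neq i.
have [[e1 e2] e3] := (negPf n1, negPf n2, negPf n3).
have [e1' e2' e3'] : [/\ (i == ordS i) = false, (ordS i == ordS (ordS i)) = false
  & (i == ordS (ordS i)) = false] by split; rewrite eq_sym.
move: (ordS i) (ordS (ordS i)) n1 n2 n3 e1 e2 e3 e1' e2' e3'.
move=> j k _ _ _ e1 e2 e3 e1' e2' e3'; pose E := (eqxx, e1, e2, e3, e1', e2', e3').
apply: wr_ext => [x|]; rewrite ?wrM2.
  rewrite !wrM1 !wrM2 !permM !ffunE perm1 !permE /=.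
  case: (eqVneq x i) => [xE|xi]; first by do 4!rewrite ?xE ?E ?mulg1 ?mul1g /=.
  case: (eqVneq x j) => [xE|xj].
    do 4!rewrite ?xE ?E /=.
    by rewrite ?mulg1 ?mul1g !mulgA mulgKV mulgKV.
  case: (eqVneq x k) => [xE|xk]; first by do 4!rewrite ?xE ?E ?mulg1 ?mul1g /=.
  by rewrite !(negPf xi, negPf xj, negPf xk) !mulg1.
apply/permP => x; rewrite !permM perm1 !permE /=.
case: (eqVneq x i) => [xE|xi]; first by do 4!rewrite ?xE ?E /=.
case: (eqVneq x j) => [xE|xj]; first by do 4!rewrite ?xE ?E /=.
case: (eqVneq x k) => [xE|xk]; first by do 4!rewrite ?xE ?E /=.
by rewrite !(negPf xi, negPf xj, negPf xk).
Qed.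

Lemma braid_rist i : braid_elt i \in rist (ordS i).
Proof.
have := braid i => /(congr1 (fun u => u * (b (ordS i) * b i * b (ordS i))^-1)).
by rewrite mulgK inE => <-; rewrite !(groupM, groupV, mem_upper).
Qed.

(** Modulo the rigid stabilizer the braid element gives a_i = a_(i+2), hence
    all a_i are equal as d is odd; the quotient of H is then cyclic. *)
Lemma rist_der x : H^`(1) \subset rist x.
Proof.
pose N := Group (rist_group_set x).
have HN : H \subset 'N(N) by apply: rist_norm.
have Na i : N :* a i = N :* a (ordS (ordS i)).
  apply/rcoset_eqP; rewrite mem_rcoset.
  have := braid_rist i; rewrite (rist_const _ x) (ristJ _ _ (ordS i)).
  by rewrite /braid_elt conjgE !mulgA mulVg mul1g mulgKV.
have NX : N <*> <[a x]> = N * <[a x]>.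
  by rewrite norm_joinEr ?cycle_subG ?(subsetP HN) ?mem_lower.
have HX : H \subset N * <[a x]>.
  rewrite -NX gen_subG; apply/subsetP => _ /imsetP[j _ ->].
  rewrite -[_ \in _]/(a j \in N <*> <[a x]>) NX.
  have : a j \in N :* a j by apply: rcoset_refl.
  rewrite (cyc_const _ x _ Na) //; apply/subsetP.
  by rewrite mulgS // sub1set cycle_id.
apply: (@der1_min _ _ N) => //.
apply: (@abelianS _ _ (<[a x]> / N)); last exact: quotient_abelian (cycle_abelian _).
by rewrite -(quotientMidl N <[a x]>) quotientS.
Qed.

Lemma even_single x h : h \in H -> ~~ sgn h -> single x h \in K.
Proof.
by move=> hH /(derH hH) /(subsetP (rist_der x)); rewrite inE.
Qed.

Lemma base_even_mem f : (forall x, f x \in H) -> (forall x, ~~ sgn (f x)) ->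
  wr f 1 \in K.
Proof.
move=> fH f0; suff P s : uniq s -> wr (fun x => if x \in s then f x else 1) 1 \in K.
  have := P _ (enum_uniq 'I_d); congr (_ \in K); apply: wr_ext => // x.
  by rewrite !ffunE mem_enum.
elim: s => [_|y s IH /= /andP[ys us]].
  have <- : 1 = wr (fun=> (1 : gT)) 1 by []; exact: group1.
have := groupM (even_single y (fH y) (f0 y)) (IH us); congr (_ \in K).
apply: wr_ext => [x|]; last by rewrite wrM2 mulg1.
rewrite wrM1 !ffunE perm1 inE.
by case: eqVneq => [->|_]; rewrite ?(negPf ys) ?mulg1 ?mul1g.
Qed.

(** A conjugate of b_i lying over the transposition of i and i + k, obtained by
    dragging one end of the transposition around the cycle. *)
Fixpoint walk i k : wreath d gT :=
  if k is k'.+1 then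
    if k' is 0 then b i else walk i k' ^ b (iter k' (@ordS d) i)
  else 1.

Lemma walk_mem i k : walk i k \in K.
Proof.
elim: k => [|[|k] IH]; rewrite /= ?group1 ?mem_upper //.
by rewrite groupJ ?mem_upper.
Qed.

(** Conjugating by b_j adds a factor a_j to the section at the fixed end and a
    factor a_j^-1 to the section at the end that moves, so both parities change
    by c at every step. *)
Lemma walkP i k : 0 < k < d ->
  (walk i k).2 = tperm i (iter k (@ordS d) i) /\
  forall x, sgn ((walk i k).1 x) = [&& odd k, c & x \in [:: i; iter k (@ordS d) i]].
Proof.
elim: k => [//|[_ _|k IH /andP[_ kd]]]; first by split=> // x; rewrite sgn_gen.
have /IH[p2 p1] : 0 < k.+1 < d by exact: ltnW.
have ij : iter k.+1 (@ordS d) i != i by apply: iter_ordS_neq; exact: ltnW.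
have ik : iter k.+2 (@ordS d) i != i by exact: iter_ordS_neq.
have -> : walk i k.+2 = walk i k.+1 ^ b (iter k.+1 (@ordS d) i) by [].
move: p1 p2 ij ik; move: (walk i k.+1) => g.
rewrite [iter k.+2 _ _]/= -[ordS (iter k _ i)]/(iter k.+1 (@ordS d) i).
move: (iter k.+1 _ i) => j p1 p2 ij ik.
have jk := ordS_neq j.
split.
  rewrite !wrM2 wrV2 p2 -conjgE tpermJ /= tpermL tpermD //.
(* The sections of g ^ b j are read off from b j * g ^ b j = g * b j. *)
move=> y; pose x := tperm j (ordS j) y.
have yE : y = tperm j (ordS j) x by rewrite tpermK.
have E : sgn ((b j).1 x) (+) sgn ((g ^ b j).1 y)
       = sgn (g.1 x) (+) sgn ((b j).1 (g.2 x)).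
  by rewrite -!sgnM {1}yE -[tperm _ _ x]/((b j).2 x) -!wrM1 -conjgC.
move: E; rewrite p2 !sgn_gen p1 !inE /x.
have [e1 e2 e3] : [/\ (j == i) = false, (ordS j == i) = false & (ordS j == j) = false].
  by split; apply/negbTE.
have [e1' e2' e3'] : [/\ (i == j) = false, (i == ordS j) = false & (j == ordS j) = false].
  by split; rewrite eq_sym.
pose F := (eqxx, e1, e2, e3, e1', e2', e3'); rewrite !permE /=.
case: (eqVneq y i) => [yi|yi].
  by do 4!rewrite ?(yi, F) /=; case: c; case: odd; case: sgn.
case: (eqVneq y j) => [yj|yj].
  by do 4!rewrite ?(yj, F) /=; case: c; case: odd; case: sgn.
case: (eqVneq y (ordS j)) => [yk|yk].
  by do 4!rewrite ?(yk, F) /=; case: c; case: odd; case: sgn.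
by rewrite !(negPf yi, negPf yj, negPf yk) /= !andbF.
Qed.

(** The transposition of i and j arises by walking k steps from i to j, or by
    walking d - k steps from j to i. The parities of k and d - k differ because
    d is odd, so the product of the two walks has trivial permutation and exactly
    two sections of parity c. *)
Lemma odd_pair i j : i != j ->
  exists2 e, e \in K & e.2 = 1 /\ forall x, sgn (e.1 x) = c && (x \in [:: i; j]).
Proof.
case/iter_ordS_onto => k kd ->; set j' := iter k _ i.
have kd' : 0 < d - k < d.
  by case/andP: kd => k0 kd; rewrite subn_gt0 kd ltn_subrL k0 (ltn_trans _ d3).
have ji : iter (d - k) (@ordS d) j' = i.
  by rewrite -iterD subnK ?iter_ordS_period //; case/andP: kd => _ /ltnW.
have [p2 p1] := walkP i kd; have [q2 q1] := walkP j' kd'.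
exists (walk i k * walk j' (d - k)); first by rewrite groupM ?walk_mem.
rewrite wrM2 p2 q2 ji -/j' [tperm j' i]tpermC tperm2; split=> // x.
rewrite wrM1 sgnM p1 q1 p2 ji -/j' oddB ?oddd; last by case/andP: kd => _ /ltnW.
rewrite !inE.
have -> : (tperm i j' x == j') || (tperm i j' x == i) = (x == i) || (x == j').
  by congr (_ || _); [rewrite -[X in _ == X](tpermL i j')
    | rewrite -[X in _ == X](tpermR i j')]; rewrite (inj_eq perm_inj).
by case: c; case: odd; case: (_ || _).
Qed.

Lemma perm_onto s : exists2 u, u \in K & u.2 = s.
Proof.
have [ts -> _] := prod_tpermP s.
elim: ts => [|[i j] ts [u uK u2]]; first by exists 1; rewrite ?group1 // big_nil.
rewrite big_cons /= -u2; case: (eqVneq i j) => [->|ij].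
  by exists u => //; rewrite tperm1 mul1g.
have [k kd ->] := iter_ordS_onto ij; have [p2 _] := walkP i kd.
by exists (walk i k * u); rewrite ?wrM2 ?p2 // groupM ?walk_mem.
Qed.

Lemma odd_section_gen h : h \in H -> sgn h -> c.
Proof.
have gH : group_set [set h | sgn h ==> c].
  apply/group_setP; split=> [|x y]; rewrite !inE ?sgn1 // sgnM.
  by case: c; case: (sgn x); case: (sgn y).
have : H \subset Group gH.
  by rewrite gen_subG; apply/subsetP => _ /imsetP[i _ ->]; rewrite inE sgna implybb.
by move=> /subsetP sH /sH; rewrite inE => /implyP.
Qed.

(** Multiplying by the elements of odd_pair removes the odd sections two at a
    time; what is left lies in a product of rigid stabilizers. *)
Lemma even_sections_base n (w : wreath d gT) : #|[set x | sgn (w.1 x)]| <= n ->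
  w \in even_sections -> w.2 = 1 -> w \in K.
Proof.
elim: n w => [|n IH] w wn we w2; have [wH w0] := even_sectionsP _ we.
  have -> : w = wr w.1 1 by apply: wr_ext => // x; rewrite ffunE.
  apply: base_even_mem => // x; apply: contraL wn => sx; rewrite -ltnNge.
  by apply/card_gt0P; exists x; rewrite inE.
case: (pickP (fun x => sgn (w.1 x))) => [x sx|noodd]; last first.
  by apply: IH => //; rewrite (eq_card (B := pred0)) ?card0 // => x; rewrite inE noodd.
have [y /andP[yx sy]] : exists y, (y != x) && sgn (w.1 y).
  apply/existsP; apply: contraR w0 => /existsPn noy.
  rewrite /sect_parity (bigD1 x) //= sx big1 // => y yx; apply/negbTE.
  by have := noy y; rewrite yx.
have ct : c by exact: odd_section_gen sx.
have [e eK [e2 e1]] := odd_pair yx.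
rewrite -(groupMl w eK); apply: IH; last by rewrite wrM2 e2 w2 mulg1.
  rewrite -ltnS; apply: leq_trans wn; apply: proper_card; apply/properP; split.
    apply/subsetP => z; rewrite !inE wrM1 e2 perm1 sgnM e1 ct !inE.
    by case: eqP => [->|_]; rewrite ?sy //; case: eqP => [->|].
  by exists x; rewrite !inE // wrM1 e2 perm1 sgnM e1 ct !inE eqxx orbT sx.
pose E := Group even_sections_group_set.
by apply: (@groupM _ E) => //; exact: (subsetP gen_sub_even_sections).
Qed.

Theorem gen_even_sections : K = even_sections.
Proof.
apply/eqP; rewrite eqEsubset gen_sub_even_sections; apply/subsetP => u uE.
have [v vK v2] := perm_onto u.2; rewrite -(groupMr u (groupVr vK)).
apply: even_sections_base (leqnn _) _ _; last by rewrite wrM2 wrV2 v2 mulgV.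
pose E := Group even_sections_group_set.
apply: (@groupM _ E) => //; rewrite groupV; exact: (subsetP gen_sub_even_sections).
Qed.

Lemma base_mem f : (forall x, f x \in H) ->
  ~~ (\big[addb/false]_x sgn (f x)) -> wr f 1 \in K.
Proof.
move=> fH f0; rewrite gen_even_sections; apply/even_sectionsP; split=> [x|].
  by rewrite ffunE.
by rewrite /sect_parity; under eq_bigr do rewrite ffunE.
Qed.

Definition two_point x y (h : gT) z := if z == x then h else if z == y then h else 1.

Lemma two_point_mem x y h : x != y -> h \in H -> wr (two_point x y h) 1 \in K.
Proof.
move=> xy hH; apply: base_mem => [z|]; rewrite /two_point.
  by case: ifP => _ //; case: ifP => _ //; exact: group1.
rewrite (bigD1 x) //= (bigD1 y) 1?eq_sym //= big1; last first.
  by move=> z /andP[zx zy]; rewrite (negPf zx) (negPf zy) sgn1.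
by rewrite !eqxx (eq_sym y) (negPf xy) addbF addbb.
Qed.

(** A commutator supported below a single letter x is the commutator of two
    elements whose supports meet only in x. The second letters y and z are
    there to satisfy the parity constraint. *)
Lemma single_der x h : h \in H^`(1) -> single x h \in K^`(1).
Proof.
have gS : group_set [set h | single x h \in K^`(1)].
  apply/group_setP; split=> [|g k]; rewrite !inE; first by rewrite single1 group1.
  by rewrite singleM; apply: groupM.
suff /subsetP sS : H^`(1) \subset Group gS by move/sS; rewrite inE.
rewrite gen_subG; apply/subsetP => _ /imset2P[h1 h2 h1H h2H ->]; rewrite inE.
have n1 := ordS_neq x; have n2 := ordS_neq (ordS x); have n3 := ordSS_neq x.
set y := ordS x in n1 n2 n3; set z := ordS y in n2 n3.
have -> : single x [~ h1, h2] = [~ wr (two_point x y h1) 1, wr (two_point x z h2) 1].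
  apply: wr_ext => [t|]; last by rewrite commgEl conjgE !wrM2 !wrV2 /= !(invg1, mulg1).
  rewrite !commgEl !conjgE !wrM1 ?wrM2 !wrV1 ?wrV2 !ffunE !(invg1, mulg1, perm1) /two_point.
  case: (eqVneq t x) => [_|tx] //.
  case: (eqVneq t y) => [ty|ty]; last by rewrite !(invg1, mulg1, mul1g) mulVg.
  by rewrite ty (eq_sym y) (negPf n2) !(invg1, mulg1, mul1g) mulVg.
by apply: mem_commg; apply: two_point_mem; rewrite // eq_sym.
Qed.

Lemma even_single_der x h : h \in H -> ~~ sgn h -> single x h \in K^`(1).
Proof. by move=> hH h0; apply/single_der/derH. Qed.

(** The commutator subgroup contains the defect of the braid relation, so
    b_i and b_(i+1) agree in the abelianization. *)
Lemma gen_der i : b i * (b (ordS i))^-1 \in K^`(1).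
Proof.
have braidH : braid_elt i \in H by rewrite !(groupM, groupV, mem_lower).
have braid0 : ~~ sgn (braid_elt i) by rewrite !sgnM !sgnV !sgna; case: c.
have := even_single_der (ordS i) braidH braid0.
have <- : b i * b (ordS i) * b i * (b (ordS i) * b i * b (ordS i))^-1
     = single (ordS i) (braid_elt i) by rewrite braid mulgK.
have [bK b'K] := (mem_upper i, mem_upper (ordS i)).
move: (b i) (b (ordS i)) bK b'K => u v uK vK.
have -> : u * v * u * (v * u * v)^-1 = u * v^-1 * [~ v^-1, u^-1] ^ v^-1.
  by rewrite commgEl !conjgE !invMg !invgK !mulgA mulgKV.
rewrite groupMr // memJ_norm ?mem_commg ?groupV //.
by rewrite (subsetP (der_norm 1 _)) // groupV.
Qed.

Lemma gen_sq_der i : b i ^+ 2 \in K^`(1).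
Proof.
have [e1 e2] : (i == ordS i) = false /\ (ordS i == i) = false.
  by rewrite eq_sym (negPf (ordS_neq i)).
have -> : b i ^+ 2 = single i (a i * a (ordS i)) * single (ordS i) (a (ordS i) * a i).
  rewrite expgS expg1; apply: wr_ext => [x|]; last by rewrite !wrM2 /= tperm2 mulg1.
  rewrite !wrM1 !ffunE perm1; case: (eqVneq x i) => [->|xi].
    by rewrite tpermL e1 e2 eqxx mulg1.
  case: (eqVneq x (ordS i)) => [->|xj]; first by rewrite tpermR eqxx mul1g.
  rewrite tpermD; [|by rewrite eq_sym|by rewrite eq_sym].
  by rewrite (negPf xi) (negPf xj) mulg1.
by apply: groupM; apply: even_single_der; rewrite ?groupM ?mem_lower // sgnM !sgna addbb.
Qed.

Lemma der_even u : u \in K^`(1) -> ~~ odd_perm u.2.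
Proof.
have gA : group_set [set u : wreath d gT | ~~ odd_perm u.2].
  apply/group_setP; split=> [|v w]; rewrite !inE ?odd_perm1 // odd_permM.
  by do 2!case: odd_perm.
suff /subsetP sA : K^`(1) \subset Group gA by move/sA; rewrite inE.
rewrite gen_subG; apply/subsetP => _ /imset2P[v w _ _ ->]; rewrite inE.
by rewrite commgEl conjgE !wrM2 !wrV2 !odd_permM !odd_permV; do 2!case: odd_perm.
Qed.

(** The abelianization of K is generated by the common image of the b_i, whose
    square is trivial: it has order two and is detected by the sign. This is
    the hypothesis on H that the next level requires. *)
Theorem even_der u : u \in K -> ~~ odd_perm u.2 -> u \in K^`(1).
Proof.
have x : 'I_d by exact: Ordinal d3.
have nK : K \subset 'N(K^`(1)) by exact: der_norm.
have Nb i : K^`(1) :* b i = K^`(1) :* b (ordS (ordS i)).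
  by apply: (@etrans _ _ (K^`(1) :* b (ordS i)));
     apply/rcoset_eqP; rewrite mem_rcoset gen_der.
have NX : K^`(1) <*> <[b x]> = K^`(1) * <[b x]>.
  by rewrite norm_joinEr ?cycle_subG ?(subsetP nK) ?mem_upper.
have : K \subset K^`(1) * <[b x]>.
  rewrite -NX gen_subG; apply/subsetP => _ /imsetP[j _ ->].
  rewrite -[_ \in _]/(b j \in K^`(1) <*> <[b x]>) NX.
  have : b j \in K^`(1) :* b j by apply: rcoset_refl.
  rewrite (cyc_const _ x _ Nb) //; apply/subsetP.
  by rewrite mulgS // sub1set cycle_id.
move=> /subsetP sK /sK /mulsgP[k _ k' /cycleP[m ->] ->].
have b2 : odd_perm (b x ^+ m).2 = odd m.
  elim: m => [|m IH]; first by rewrite odd_perm1.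
  by rewrite expgS wrM2 odd_permM IH odd_tperm eq_sym ordS_neq.
rewrite wrM2 odd_permM (negPf (der_even k')) b2 /= => m0; rewrite groupMl //.
by rewrite -(odd_double_half m) (negPf m0) add0n -muln2 mulnC expgM groupX ?gen_sq_der.
Qed.

(** Multiplying one section by an odd a_x exchanges the section tuples of even
    and odd total parity, so exactly half of the tuples over H are allowed. *)
Theorem card_gen : c -> (#|K| * 2 = d`! * #|H| ^ d)%N.
Proof.
move=> ct; have x : 'I_d by exact: Ordinal d3.
pose par (f : {ffun 'I_d -> gT}) := \big[addb/false]_x sgn (f x).
pose F := [set f : {ffun 'I_d -> gT} | f \in ffun_on (mem H)].
pose E := [set f in F | ~~ par f]; pose O := [set f in F | par f].
have KE : K = setX E [set: 'S_d].
  rewrite gen_even_sections; apply/setP => -[f s]; rewrite !inE andbT.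
  by congr (_ && _); apply/forallP/ffun_onP.
pose T (f : {ffun 'I_d -> gT}) := [ffun y => if y == x then a x * f y else f y].
have injT : injective T.
  move=> f g /ffunP fg; apply/ffunP => y; have := fg y; rewrite !ffunE.
  by case: ifP => // _ /mulgI.
have TF f : f \in F -> T f \in F.
  rewrite !inE => /ffun_onP fH; apply/ffun_onP => y; rewrite ffunE.
  by case: ifP => _; rewrite ?groupM ?mem_lower.
have Tpar f : par (T f) = ~~ par f.
  rewrite /par (bigD1 x) //= [in RHS](bigD1 x) //= ffunE eqxx sgnM sgna ct -addbA.
  by congr (~~ (_ (+) _)); apply: eq_bigr => y /negPf yx; rewrite ffunE yx.
have EO : #|E| = #|O|.
  have TE : T @: E \subset O.
    apply/subsetP => _ /imsetP[f /setIdP[fF pf] ->].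
    by apply/setIdP; rewrite TF // Tpar.
  have TO : T @: O \subset E.
    apply/subsetP => _ /imsetP[f /setIdP[fF pf] ->].
    by apply/setIdP; rewrite TF // Tpar negbK.
  apply/eqP; rewrite eqn_leq -{1}(card_imset E injT) subset_leq_card //.
  by rewrite -(card_imset O injT) subset_leq_card.
have sumEO : (#|E| + #|O| = #|H| ^ d)%N.
  have <- : #|F| = (#|H| ^ d)%N by rewrite cardsE card_ffun_on card_ord.
  rewrite -(cardsID [set f | par f] F) addnC; congr (_ + _)%N.
    by apply: eq_card => f; rewrite !inE.
  by apply: eq_card => f; rewrite !inE andbC.
rewrite KE cardsX cardsT card_Sn -sumEO -EO addnn -muln2.
by rewrite -mulnA mulnCA.
Qed.
End LevelStep.

(** * The tower of finite quotients *)

(** The group level k is Aut(T) acting on the words of length k. The trivial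
    group at the bottom is the symmetric group on the empty set. *)
Section Tower.
Variable d : nat.

Fixpoint level k : finGroupType :=
  if k is k'.+1 then wreath d (level k') else {perm 'I_0}.

Fixpoint lgen k : 'I_d -> level k :=
  if k is k'.+1 then wr_gen (@lgen k') else fun=> 1.

Definition lsgn k : level k -> bool :=
  if k is k'.+1 then fun u : wreath d (level k') => odd_perm u.2 else fun=> false.

Definition lgroup k : {group level k} := <<[set lgen k i | i : 'I_d]>>%G.

Lemma lsgnM k (u v : level k) : lsgn (u * v) = lsgn u (+) lsgn v.
Proof. by case: k u v => [//|k] u v; exact: odd_permM. Qed.

Lemma card_level0 : #|level 0| = 1%N.
Proof. by rewrite card_Sn. Qed.

Lemma card_levelS k : #|level k.+1| = (d`! * #|level k| ^ d)%N.
Proof. by rewrite mulnC card_prod card_ffun card_ord card_Sn. Qed.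

Lemma level0_eq (u v : level 0) : u = v.
Proof. by apply/permP => -[]. Qed.

Hypotheses (d3 : 3 <= d) (oddd : odd d).

Lemma lsgn_gen k i : lsgn (lgen k i) = (0 < k).
Proof. by case: k => //= k; rewrite odd_tperm eq_sym ordS_neq. Qed.

Lemma lgroup_der k h : h \in lgroup k -> ~~ lsgn h -> h \in (lgroup k)^`(1).
Proof.
elim: k h => [|k IH] h; first by rewrite (level0_eq h 1) group1.
exact: (even_der d3 oddd (@lsgnM k) (@lsgn_gen k) IH).
Qed.

(** Over the trivial group the parity constraint is void, so the first level
    carries the full symmetric group. *)
Lemma card_lgroup1 : #|lgroup 1| = d`!.
Proof.
have -> : lgroup 1 = [set: level 1] :> {set _}.
  rewrite /lgroup /= (gen_even_sections d3 oddd (@lsgnM 0) (@lsgn_gen 0) (@lgroup_der 0)).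
  apply/setP => u; rewrite in_setT; apply/even_sectionsP; split=> [x|].
    by rewrite (level0_eq (u.1 x) 1) group1.
  by rewrite /sect_parity big1.
by rewrite cardsT card_levelS card_level0 exp1n muln1.
Qed.

Lemma card_lgroupSS k : (#|lgroup k.+2| * 2 = d`! * #|lgroup k.+1| ^ d)%N.
Proof.
exact: (card_gen d3 oddd (@lsgnM k.+1) (@lsgn_gen k.+1) (@lgroup_der k.+1)).
Qed.

End Tower.

(** * Tree automorphisms and their actions on levels *)

Section Action.
Variable d : nat.
Implicit Types w : word d.

Fixpoint lact k : level d k -> word d -> word d :=
  match k with
  | 0 => fun _ w => w
  | k'.+1 => fun (u : wreath d (level d k')) w =>
      if w is x :: v then u.2 x :: lact (u.1 x) v else [::]
  end.

Lemma lactM k (u v : level d k) w : lact (u * v) w = lact v (lact u w).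
Proof.
elim: k u v w => [//|k IH] u v [//|x w] /=.
by rewrite permM wrM1 IH.
Qed.

Lemma lact1 k w : lact (1 : level d k) w = w.
Proof. by elim: k w => [//|k IH] [//|x w] /=; rewrite perm1 wr11 IH. Qed.

Lemma lact_nil k (u : level d k) : lact u [::] = [::].
Proof. by case: k u. Qed.

Lemma lactK k (u : level d k) : cancel (lact u) (lact u^-1).
Proof. by move=> w; rewrite -lactM mulgV lact1. Qed.

Lemma lactKV k (u : level d k) : cancel (lact u^-1) (lact u).
Proof. by move=> w; rewrite -lactM mulVg lact1. Qed.

Lemma lact_rcons k (u : level d k) w x :
  exists y, lact u (rcons w x) = rcons (lact u w) y.
Proof.
elim: k u w => [|k IH] u [|z w] /=; try by [exists x | exists (u.2 x); rewrite lact_nil].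
by have [y ->] := IH (u.1 z) w; exists y.
Qed.

Lemma lact_inj k (u v : level d k) : 0 < d ->
  (forall w, size w = k -> lact u w = lact v w) -> u = v.
Proof.
move=> d0; elim: k u v => [|k IH] u v E; first exact: level0_eq.
apply: wr_ext => [x|].
  by apply: IH => w wk; case: (E (x :: w) (congr1 succn wk)).
apply/permP => x; have := E (x :: nseq k (Ordinal d0)).
by rewrite /= size_nseq => /(_ erefl) [].
Qed.

Lemma lact_tree_aut k (u : level d k) : is_tree_aut (lact u).
Proof.
split; [by exists (lact u^-1); [exact: lactK|exact: lactKV]|exact: lact_nil|].
move=> w w'; split=> -[x [] E].
- have [y Ey] := lact_rcons u^-1 (lact u w) x.
  by exists y; left; rewrite -(lactK u w') E Ey lactK.
- have [y Ey] := lact_rcons u^-1 (lact u w') x.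
  by exists y; right; rewrite -(lactK u w) E Ey lactK.
- by rewrite E; have [y ->] := lact_rcons u w x; exists y; left.
- by rewrite E; have [y ->] := lact_rcons u w' x; exists y; right.
Qed.

(** What restriction to a subtree keeps of a tree automorphism. Working with
    bare functions avoids proving that sections are again bijective. *)
Definition prefix_fun (f : word d -> word d) :=
  [/\ injective f, f [::] = [::] & forall w x, exists y, f (rcons w x) = rcons (f w) y].

Lemma prefix_fun_size f w : prefix_fun f -> size (f w) = size w.
Proof.
case=> _ f0 fr; elim/last_ind: w => [|w x IH]; first by rewrite f0.
by have [y ->] := fr w x; rewrite !size_rcons IH.
Qed.

(** Automorphisms are only assumed to preserve adjacency. A child of w could a
    priori be sent to the parent of the image of w; by induction that parent
    is the image of the parent of w, which contradicts injectivity. *)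
Lemma tree_aut_prefix f : is_tree_aut f -> prefix_fun f.
Proof.
case=> bf f0 fA; have injf := bij_inj bf; split=> // w.
elim/last_ind: w => [|w z IH] x.
  have [y [E|E]] : Defs.adjacent (f [::]) (f [:: x]) by apply/fA; exists x; left.
    by exists y; rewrite -E.
  by move/(congr1 size): E; rewrite f0 size_rcons.
have : Defs.adjacent (f (rcons w z)) (f (rcons (rcons w z) x)).
  by apply/fA; exists x; left.
move=> -[y []]; first by exists y.
have [t ->] := IH z => /rcons_inj[/injf /(congr1 size)].
by rewrite !size_rcons => E _; exfalso; move: E; elim: (size w) => // n + [].
Qed.

Lemma size_tree_aut (g : tree_aut d) w : size (g w) = size w.
Proof. exact/prefix_fun_size/tree_aut_prefix/tree_autP. Qed.

(** The permutation and the sections are read off from the images of the words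
    of length 1 and of their extensions. *)
Lemma lact_exists k f : prefix_fun f ->
  exists u : level d k, forall w, size w = k -> f w = lact u w.
Proof.
elim: k f => [|k IH] f [injf f0 fr]; first by exists 1 => -[].
pose p x := head x (f [:: x]).
have fp x : f [:: x] = [:: p x].
  by rewrite /p; have [y ->] := fr [::] x; rewrite f0.
have injp : injective p.
  by move=> x y E; have [] // : [:: x] = [:: y]; apply: injf; rewrite !fp E.
pose s x v := behead (f (x :: v)).
have fs x v : f (x :: v) = p x :: s x v.
  rewrite /s; elim/last_ind: v => [|v y IHv]; first by rewrite fp.
  by have [z] := fr (x :: v) y; rewrite rcons_cons IHv => ->.
have sP x : prefix_fun (s x).
  split=> [v v' E||v y]; last 1 first.
  - by have [z] := fr (x :: v) y; rewrite rcons_cons !fs rcons_cons => -[->]; exists z.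
  - have [] // : x :: v = x :: v' by apply: injf; rewrite !fs E.
  - by rewrite /s fp.
have /choice[u uP] x := IH _ (sP x).
exists (wr u (perm injp)) => -[//|x v] [vk].
by rewrite fs /= permE ffunE -uP.
Qed.
End Action.

(** * Indices of level stabilizers *)

Section Index.
Variables (d : nat) (d0 : 0 < d).
Local Open Scope classical_set_scope.

(** Two elements of G lie in the same left coset of the stabilizer exactly when
    they act alike on the words of length k, so a coset is a fibre of the
    restriction to that level. *)
Lemma group_index_level (G : set (tree_aut d)) k (im : {set level d k}) :
  is_subgroup G ->
  (forall u, u \in im <->
     exists2 g, G g & forall w, size w = k -> g w = lact u w) ->
  group_index G (level_stab G k) = #|im|.
Proof.
case=> G1 GM GV imP.
pose phi (u : level d k) := [set g | G g /\ forall w, size w = k -> g w = lact u w].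
have cosetE g u : G g -> (forall w, size w = k -> g w = lact u w) ->
    [set (g * h)%g | h in level_stab G k] = phi u.
  move=> Gg gu; apply/seteqP; split=> [_ [h [Gh hk] <-]|g' [Gg' g'u]].
    by split=> [|w wk]; [exact: GM|rewrite /= hk ?size_tree_aut // gu].
  exists (g^-1 * g')%g; last by rewrite mulKVg.
  split=> [|w wk]; first by apply: GM => //; exact: GV.
  have Vk : size ((g^-1)%g w) = k by rewrite size_tree_aut.
  by rewrite /= g'u // -gu //; exact: (congr1 (fun h : tree_aut d => h w) (mulVg g)).
have inj_phi : {in im &, injective phi}.
  move=> u v /imP[g Gg gu] _ E; apply: lact_inj => // w wk.
  have [_ gv] : phi v g by rewrite -E.
  by rewrite -gu // gv.
rewrite /group_index.
have -> : [set [set (g * h)%g | h in level_stab G k] | g in G]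
    = [set` [fset phi u | u in im]%fset].
  apply/seteqP; split=> [_ [g Gg <-]|_ /imfsetP[u /= uim ->]] /=.
    have [u uP] := lact_exists k (tree_aut_prefix (tree_autP g)).
    by apply/imfsetP; exists u; [apply/imP; exists g|rewrite (cosetE g u)].
  by have /imP[g Gg gu] := uim; exists g => //; exact: cosetE.
by rewrite set_fsetK card_in_imfset //= -cardE.
Qed.

Lemma index_Aut k :
  group_index [set: tree_aut d] (level_stab [set: tree_aut d] k) = #|level d k|.
Proof.
rewrite -cardsT; apply: group_index_level => // u; rewrite in_setT.
by split=> // _; exists (TreeAut (lact_tree_aut u)).
Qed.

Lemma gen_fun_lact k (i : 'I_d) (w : word d) :
  size w = k -> gen_fun i w = lact (lgen k i) w.
Proof.
elim: k i w => [|k IH] i [//|x w] //= [wk]; congr (_ :: _).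
by rewrite ffunE; case: eqP => _; [|case: eqP => _]; rewrite ?lact1 ?IH.
Qed.

Lemma Gd_subgroup : is_subgroup (@Gd d).
Proof.
split=> [H [[H1 _ _] _] //|g h Gg Gh H HP|g Gg H HP].
  by case: (HP) => -[_ HM _] _; apply: HM; [exact: Gg|exact: Gh].
by case: (HP) => -[_ _ HV] _; apply: HV; exact: Gg.
Qed.

Lemma Gd_gen (i : 'I_d) : @Gd d (gen i).
Proof. by move=> H [_]; apply; exists i. Qed.

Lemma index_Gd k : group_index (@Gd d) (level_stab (@Gd d) k) = #|lgroup d k|.
Proof.
apply: group_index_level => [|u]; first exact: Gd_subgroup.
have [G1 GM GV] := Gd_subgroup.
pose agree (g : tree_aut d) (u : level d k) := forall w, size w = k -> g w = lact u w.
have agreeM g h v v' : agree g v -> agree h v' -> agree (g * h)%g (v * v')%g.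
  by move=> gv hv w wk; rewrite lactM -gv // -hv ?size_tree_aut.
split.
  pose I := [set u | `[< exists2 g, @Gd d g & agree g u >]]%SET.
  have gI : group_set I.
    apply/group_setP; split=> [|u' v']; rewrite !inE.
      by apply/asboolP; exists 1%g => // w _; rewrite lact1.
    move=> /asboolP[g Gg gu] /asboolP[h Gh hv]; apply/asboolP.
    by exists (g * h)%g; [exact: GM|exact: agreeM].
  suff /subsetP sI : lgroup d k \subset Group gI.
    by move/sI; rewrite inE => /asboolP.
  rewrite gen_subG; apply/subsetP => _ /imsetP[i _ ->]; rewrite inE.
  apply/asboolP; exists (gen i); [exact: Gd_gen|exact: gen_fun_lact].
case=> g Gg gu.
suff [v vk gv] : exists2 v, v \in lgroup d k & agree g v.
  by rewrite (lact_inj d0 (u := u) (v := v)) // => w wk; rewrite -gu // gv.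
apply: (Gg [set g | exists2 v, v \in lgroup d k & agree g v]).
split; last first.
  by move=> _ [i _ <-]; exists (lgen k i);
    [apply: mem_gen; apply: imset_f|exact: gen_fun_lact].
split=> [|h h' [v vk hv] [v' vk' hv']|h [v vk hv]].
- by exists 1%g; rewrite ?group1 // => w _; rewrite lact1.
- by exists (v * v')%g; [exact: groupM|exact: agreeM].
exists v^-1%g; first by rewrite groupV.
move=> w wk; have Vk : size ((h^-1)%g w) = k by rewrite size_tree_aut.
rewrite -[LHS](lactK v) -hv //; congr lact.
exact: (congr1 (fun g : tree_aut d => g w) (mulVg h)).
Qed.
End Index.

(** * Growth of the indices and the dimension *)

Section Dimension.
Variables (R : realType) (d : nat).
Hypotheses (d3 : (3 <= d)%N) (oddd : odd d).
Import GRing.Theory Num.Theory Order.TTheory numFieldNormedType.Exports.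
Local Open Scope ring_scope.
Local Open Scope classical_set_scope.

(** The number of vertices of T of length less than k. *)
Fixpoint nvertices k : nat := if k is k'.+1 then (d * nvertices k').+1 else 0.

Lemma leq_nvertices k : (k <= nvertices k)%N.
Proof.
elim: k => [//|k IH]; rewrite /= ltnS (leq_trans IH) // leq_pmull //.
exact: leq_trans d3.
Qed.

Lemma nverticesS k : (nvertices k.+1)%:R = d%:R * (nvertices k)%:R + 1 :> R.
Proof. by rewrite /= -addn1 natrD natrM. Qed.

Let D : R := ln (d`!)%:R.

Let fact0 : 0 < (d`!)%:R :> R. Proof. by rewrite ltr0n fact_gt0. Qed.

Lemma ln_fact_gt0 : 0 < D.
Proof. by rewrite ln_gt0 // ltr1n (leq_trans _ (fact_geq d)) // (leq_trans _ d3). Qed.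

Lemma ln_card_level k : ln (#|level d k|)%:R = (nvertices k)%:R * D.
Proof.
suff [-> _] : ln (#|level d k|)%:R = (nvertices k)%:R * D /\ (0 < #|level d k|)%N by [].
elim: k => [|k [IH I0]]; first by rewrite card_level0 ln1 mul0r.
rewrite card_levelS muln_gt0 fact_gt0 expn_gt0 I0; split=> //.
rewrite natrM natrX lnM ?posrE ?exprn_gt0 ?ltr0n ?fact_gt0 //.
by rewrite lnXn ?ltr0n // IH nverticesS -[_ *+ d]mulr_natl -/D; ring.
Qed.

(** The group loses one bit for each vertex whose children are still among the
    vertices acted upon, that is, for each vertex of length less than k. *)
Lemma ln_card_lgroup k :
  ln (#|lgroup d k.+1|)%:R = (nvertices k.+1)%:R * D - (nvertices k)%:R * ln 2.
Proof.
elim: k => [|k IH]; first by rewrite card_lgroup1 //= muln0 mul1r mul0r subr0.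
have := congr1 (fun n => ln n%:R : R) (card_lgroupSS d3 oddd k).
have p m : 0 < (#|lgroup d m|)%:R :> R by rewrite ltr0n cardG_gt0.
rewrite !natrM natrX !lnM ?posrE ?exprn_gt0 // lnXn // IH -/D.
move=> /(canRL (addrK _)) ->.
by rewrite !nverticesS -[_ *+ d]mulr_natl; ring.
Qed.

End Dimension.

Import GRing.Theory Num.Theory Order.TTheory numFieldNormedType.Exports.
Local Open Scope ring_scope.
Local Open Scope classical_set_scope.

Theorem theorem5p6 (R : realType) (d : nat) (hd3 : (3 <= d)%N) (hodd : odd d) :
  dimH_closure R (@Gd d) = (1 - ln 2 / (d%:R * ln (d`!)%:R))%R%:E.
Proof.
have d0 : (0 < d)%N by exact: leq_trans hd3.
pose D : R := ln (d`!)%:R.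
pose c : R := ln 2 / (d%:R * D).
rewrite /dimH_closure -/D -/c; apply: (cvg_limn_einf_sup _).1.
(* The shift discards level 0, where both logarithms vanish. *)
rewrite -cvg_shiftS /=.
have -> : (fun k => (ln (group_index (@Gd d) (level_stab (@Gd d) k.+1))%:R
    / ln (group_index [set: tree_aut d] (level_stab [set: tree_aut d] k.+1))%:R)%:E)
  = EFin \o (fun k => 1 - c + c * (nvertices d k.+1)%:R^-1 : R).
  apply/funext => k /=; congr EFin.
  rewrite index_Gd // index_Aut // ln_card_level ln_card_lgroup // -/D.
  have D0 := lt0r_neq0 (ln_fact_gt0 R hd3).
  have dR0 : d%:R != 0 :> R by rewrite pnatr_eq0 -lt0n.
  have s0 : (nvertices d k.+1)%:R != 0 :> R by rewrite pnatr_eq0.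
  move: s0; rewrite nverticesS /c; move: (nvertices d k)%:R (ln 2) => s L s0.
  by field; rewrite D0 dR0 s0.
suff lim_real : (fun k => 1 - c + c * (nvertices d k.+1)%:R^-1 : R) @ \oo --> 1 - c.
  by apply: cvg_EFin => //; near=> k.
rewrite [X in _ --> X](_ : _ = 1 - c + c * 0); last by rewrite mulr0 addr0.
apply: cvgD; first exact: cvg_cst.
apply: cvgM; first exact: cvg_cst.
apply: (@squeeze_cvgr _ _ _ _ (fun=> 0) harmonic); last exact: cvg_harmonic.
- near=> k; rewrite invr_ge0 ler0n /= lef_pV2 ?posrE ?ltr0n // ler_nat.
  exact: leq_nvertices hd3 _.
- exact: cvg_cst.
Unshelve. all: by end_near.
Qed.
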